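(* Let $(c^{n},\bar\mu_c^{n},\bar p^{n},\tilde{\boldsymbol u}^n,\boldsymbol{u}^{n})_{n\ge 0}$, $\boldsymbol{u}^n=(u^n,v^n)$, $\tilde{\boldsymbol u}^n=(\tilde u^n,\tilde v^n)$, be grid functions such that, for every $n\ge 0$, the data at levels $n$ and $n+1$ satisfy the fully discrete projection scheme (equations (J1)--(J7) of the context), and such that the discrete boundary conditions of the context hold at every level. Write $\rho^n=\rho(c^n)$. Then the total mass of the binary fluid is conserved: $$(\rho^{n+1},1)_2=(\rho^{n},1)_2\qquad\text{for all } n\ge 0 .$$
   Context: **Parameters and material functions.** $M,Re,We,Fr,Pe,\eta,\epsilon,\rho_1,\rho_2,\mu_1,\mu_2,\delta t>0$ are constants; $\alpha=(\rho_2-\rho_1)/(\rho_1\rho_2)$; $\rho(c)=\rho_1\rho_2/((\rho_2-\rho_1)c+\rho_1)$; $\mu(c)=\mu_1\mu_2/((\mu_2-\mu_1)c+\mu_1)$ (viscosity); $m(c)=\sqrt{c^2(1-c)^2+\epsilon}$; $F(c)=c^2(c-1)^2/4$; $g(a,b)=\frac14\big(a(a-1)+b(b-1)\big)(a+b-1)$; $r(a,b)=-\alpha\rho(a)\rho(b)$. All values of $c^n$ are such that $(\rho_2-\rho_1)c+\rho_1>0$ and $(\mu_2-\mu_1)c+\mu_1>0$. Superscript $n$ denotes time level $n\delta t$; $\rho^n=\rho(c^n)$, $\rho^{n+\frac12}=\frac12(\rho^{n+1}+\rho^n)$, $c^{n+\frac12}=\frac12(c^{n+1}+c^n)$, $F^{n+\frac12}=\frac12(F(c^{n+1})+F(c^n))$.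 **Grid.** $\Omega=(0,L_x)\times(0,L_y)$, $L_x=m_1h$, $L_y=m_2h$, $h>0$, $m_1,m_2$ positive integers, $L_x=L_y$. Points: $x_i=(i-\frac12)h$, $x_{i+\frac12}=ih$, $y_j=(j-\frac12)h$, $y_{j+\frac12}=jh$. Cell-centered functions $\phi_{i,j}$ ($c,\bar\mu_c,\mu_c,\bar p$) are indexed by $0\le i\le m_1+1$, $0\le j\le m_2+1$ (indices $0$, $m_1+1$, $m_2+1$ are ghost points). East-west edge-centered functions $u_{i+\frac12,j}$, $\tilde u_{i+\frac12,j}$ live at $(x_{i+\frac12},y_j)$, $0\le i\le m_1$, $1\le j\le m_2$ (for $\tilde u$ also the ghost indices $j=0,m_2+1$); north-south edge-centered functions $v_{i,j+\frac12}$, $\tilde v_{i,j+\frac12}$ at $(x_i,y_{j+\frac12})$, $1\le i\le m_1$, $0\le j\le m_2$ (for $\tilde v$ also the ghost indices $i=0,m_1+1$); vertex-centered functions $f_{i+\frac12,j+\frac12}$, $0\le i\le m_1$, $0\le j\le m_2$. Operators are evaluated only where needed below; products of grid functions at the same type of points are pointwise. $(\phi,\psi)_2=\sum_{i=1}^{m_1}\sum_{j=1}^{m_2}\phi_{i,j}\psi_{i,j}$. **Operators.** - Edge to center: $a_xu_{i,j}=\frac12(u_{i+\frac12,j}+u_{i-\frac12,j})$, $d_xu_{i,j}=\frac1h(u_{i+\frac12,j}-u_{i-\frac12,j})$, $a_yv_{i,j}=\frac12(v_{i,j+\frac12}+v_{i,j-\frac12})$, $d_yv_{i,j}=\frac1h(v_{i,j+\frac12}-v_{i,j-\frac12})$.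 - Center to edge: $A_x\phi_{i+\frac12,j}=\frac12(\phi_{i+1,j}+\phi_{i,j})$, $D_x\phi_{i+\frac12,j}=\frac1h(\phi_{i+1,j}-\phi_{i,j})$, $A_y\phi_{i,j+\frac12}=\frac12(\phi_{i,j+1}+\phi_{i,j})$, $D_y\phi_{i,j+\frac12}=\frac1h(\phi_{i,j+1}-\phi_{i,j})$. - Center to vertex: $\mathcal A\phi_{i+\frac12,j+\frac12}=\frac14(\phi_{i+1,j+1}+\phi_{i,j+1}+\phi_{i+1,j}+\phi_{i,j})$. - Edge to vertex: $\mathcal A_xv_{i+\frac12,j+\frac12}=\frac12(v_{i+1,j+\frac12}+v_{i,j+\frac12})$, $\mathcal D_xv_{i+\frac12,j+\frac12}=\frac1h(v_{i+1,j+\frac12}-v_{i,j+\frac12})$, $\mathcal A_yu_{i+\frac12,j+\frac12}=\frac12(u_{i+\frac12,j+1}+u_{i+\frac12,j})$, $\mathcal D_yu_{i+\frac12,j+\frac12}=\frac1h(u_{i+\frac12,j+1}-u_{i+\frac12,j})$. - Vertex to edge: $\mathfrak A_xf_{i,j+\frac12}=\frac12(f_{i+\frac12,j+\frac12}+f_{i-\frac12,j+\frac12})$, $\mathfrak D_xf_{i,j+\frac12}=\frac1h(f_{i+\frac12,j+\frac12}-f_{i-\frac12,j+\frac12})$, $\mathfrak A_yf_{i+\frac12,j}=\frac12(f_{i+\frac12,j+\frac12}+f_{i+\frac12,j-\frac12})$, $\mathfrak D_yf_{i+\frac12,j}=\frac1h(f_{i+\frac12,j+\frac12}-f_{i+\frac12,j-\frac12})$.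 - Special advection terms: $a_x(\rho_{ew}D_xc\,u)_{i,j}=\frac12\big(\rho_{i+1,j}D_xc_{i+\frac12,j}u_{i+\frac12,j}+\rho_{i-1,j}D_xc_{i-\frac12,j}u_{i-\frac12,j}\big)$ and $a_y(\rho_{ns}D_yc\,v)_{i,j}=\frac12\big(\rho_{i,j+1}D_yc_{i,j+\frac12}v_{i,j+\frac12}+\rho_{i,j-1}D_yc_{i,j-\frac12}v_{i,j-\frac12}\big)$. - Special surface tension terms: $A_x(\rho_{ew}\bar\mu_c)_{i+\frac12,j}=\frac12(\rho_{i+1,j}\bar\mu_{c\,i,j}+\rho_{i,j}\bar\mu_{c\,i+1,j})$ and $A_y(\rho_{ns}\bar\mu_c)_{i,j+\frac12}=\frac12(\rho_{i,j+1}\bar\mu_{c\,i,j}+\rho_{i,j}\bar\mu_{c\,i,j+1})$. - Cell-centered squared gradient: $|\nabla_Dc|^2=a_x\big((D_xc)^2\big)+a_y\big((D_yc)^2\big)$, and $(|\nabla_Dc|^2)^{n+\frac12}=\frac12\big(|\nabla_Dc^{n+1}|^2+|\nabla_Dc^{n}|^2\big)$. **Projection scheme.** (J1),(J3) hold at interior east-west edges ($1\le i\le m_1-1$, $1\le j\le m_2$), (J2),(J4) at interior north-south edges ($1\le i\le m_1$, $1\le j\le m_2-1$), (J5)--(J7) at cells $1\le i\le m_1$, $1\le j\le m_2$. (J1) $A_x\rho^n\frac{\tilde u^{n+1}-u^n}{\delta t}+A_x(\rho^na_xu^n\,d_x\tilde u^{n+1})+\mathfrak A_y(\mathcal A\rho^n\mathcal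 A_xv^n\mathcal D_y\tilde u^{n+1})+\frac12\tilde u^{n+1}\Big(\frac{A_x\rho^{n+1}-A_x\rho^n}{\delta t}+D_x(\rho^na_xu^n)+\mathfrak D_y(\mathcal A\rho^n\mathcal A_xv^n)\Big)=\frac1{Re}\big(D_x(\mu(c^n)d_x\tilde u^{n+1})+\mathfrak D_y(\mathcal A\mu(c^n)\mathcal D_y\tilde u^{n+1})\big)+\frac1{3Re}D_x\big(\mu(c^n)(d_x\tilde u^{n+1}+d_y\tilde v^{n+1})\big)$ (J2) $A_y\rho^n\frac{\tilde v^{n+1}-v^n}{\delta t}+\mathfrak A_x(\mathcal A\rho^n\mathcal A_yu^n\mathcal D_x\tilde v^{n+1})+A_y(\rho^na_yv^n\,d_y\tilde v^{n+1})+\frac12\tilde v^{n+1}\Big(\frac{A_y\rho^{n+1}-A_y\rho^n}{\delta t}+\mathfrak D_x(\mathcal A\rho^n\mathcal A_yu^n)+D_y(\rho^na_yv^n)\Big)=\frac1{Re}\big(\mathfrak D_x(\mathcal A\mu(c^n)\mathcal D_x\tilde v^{n+1})+D_y(\mu(c^n)d_y\tilde v^{n+1})\big)+\frac1{3Re}D_y\big(\mu(c^n)(d_x\tilde u^{n+1}+d_y\tilde v^{n+1})\big)$ (J3) $A_x\rho^{n+1}\frac{u^{n+1}-\tilde u^{n+1}}{\delta t}=-\frac1MD_x\bar p^{n+1}+\frac1MA_x(\rho^{n+1}_{ew}\bar\mu_c^{n+1})D_xc^{n+1}$ (J4) $A_y\rho^{n+1}\frac{v^{n+1}-\tilde v^{n+1}}{\delta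 t}=-\frac1MD_y\bar p^{n+1}+\frac1MA_y(\rho^{n+1}_{ns}\bar\mu_c^{n+1})D_yc^{n+1}-\frac1{Fr}A_y\rho^{n+1}$ (J5) $d_xu^{n+1}+d_yv^{n+1}=\alpha\,Q^{n+1}$, where $Q^{n+1}=\frac1{Pe}\big[d_x(A_xm(c^n)D_x\bar\mu_c^{n+1})+d_y(A_ym(c^n)D_y\bar\mu_c^{n+1})\big]+\frac{\alpha}{Pe}\big[d_x(A_xm(c^n)D_x\bar p^{n+1})+d_y(A_ym(c^n)D_y\bar p^{n+1})\big]$ (J6) $\rho^{n}\frac{c^{n+1}-c^n}{\delta t}+a_x(\rho^{n+1}_{ew}D_xc^{n+1}u^{n+1})+a_y(\rho^{n+1}_{ns}D_yc^{n+1}v^{n+1})=Q^{n+1}$ (J7) $\rho^{n}\bar\mu_c^{n+1}=\frac{M\eta}{\epsilon We}\rho^{n+\frac12}g(c^{n+1},c^n)+\frac{M\eta}{\epsilon We}F^{n+\frac12}r(c^{n+1},c^n)+\frac{\epsilon\eta M}{2We}(|\nabla_Dc|^2)^{n+\frac12}r(c^{n+1},c^n)-\frac{\epsilon\eta M}{We}\big[d_x(A_x\rho^{n+\frac12}D_xc^{n+\frac12})+d_y(A_y\rho^{n+\frac12}D_yc^{n+\frac12})\big]$ **Boundary conditions (all levels).** With $\mu_c^n:=\bar\mu_c^n+\alpha\bar p^n$, both $\phi=c^n$ and $\phi=\mu_c^n$ satisfy the discrete Neumann conditions $\phi_{0,j}=\phi_{1,j}$, $\phi_{m_1+1,j}=\phi_{m_1,j}$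 ($1\le j\le m_2$), $\phi_{i,0}=\phi_{i,1}$, $\phi_{i,m_2+1}=\phi_{i,m_2}$ ($1\le i\le m_1$). The intermediate velocity satisfies no-slip: $\tilde u_{\frac12,j}=\tilde u_{m_1+\frac12,j}=0$ ($1\le j\le m_2$), $\frac12(\tilde u_{i+\frac12,0}+\tilde u_{i+\frac12,1})=\frac12(\tilde u_{i+\frac12,m_2}+\tilde u_{i+\frac12,m_2+1})=0$ ($0\le i\le m_1$), $\tilde v_{i,\frac12}=\tilde v_{i,m_2+\frac12}=0$ ($1\le i\le m_1$), $\frac12(\tilde v_{0,j+\frac12}+\tilde v_{1,j+\frac12})=\frac12(\tilde v_{m_1,j+\frac12}+\tilde v_{m_1+1,j+\frac12})=0$ ($0\le j\le m_2$). The velocity satisfies $\boldsymbol n\cdot\boldsymbol u=0$: $u_{\frac12,j}=u_{m_1+\frac12,j}=0$ ($1\le j\le m_2$), $v_{i,\frac12}=v_{i,m_2+\frac12}=0$ ($1\le i\le m_1$). *)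

(* Defs.v *)
From mathcomp Require Import all_boot all_order all_algebra.
From mathcomp Require Import reals.

Set Implicit Arguments.
Unset Strict Implicit.
Unset Printing Implicit Defensive.

Import Order.TTheory GRing.Theory Num.Theory.
Local Open Scope ring_scope.

(* A grid function is a total function of a pair of natural numbers, whose
   values outside the index range of the grid are never read.  A half-integer
   index i + 1/2 is stored at i:
     center   phi_{i,j}          is  phi (i, j)
     ew_edge  u_{i+1/2,j}        is  u (i, j)
     ns_edge  v_{i,j+1/2}        is  v (i, j)
     vertex   f_{i+1/2,j+1/2}    is  f (i, j)
   so that the index i - 1/2 is stored at i.-1; operators which read it are
   only evaluated at i >= 1, where i.-1 is not truncated.  Pointwise products
   are the library's [f \* g]. *)

Definition center (R : realType) := nat * nat -> R.
Definition ew_edge (R : realType) := nat * nat -> R.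
Definition ns_edge (R : realType) := nat * nat -> R.
Definition vertex (R : realType) := nat * nat -> R.

Definition a_x (R : realType) (u : ew_edge R) : center R :=
  fun '(i, j) => 2^-1 * (u (i, j) + u (i.-1, j)).
Definition d_x (R : realType) (h : R) (u : ew_edge R) : center R :=
  fun '(i, j) => h^-1 * (u (i, j) - u (i.-1, j)).
Definition a_y (R : realType) (v : ns_edge R) : center R :=
  fun '(i, j) => 2^-1 * (v (i, j) + v (i, j.-1)).
Definition d_y (R : realType) (h : R) (v : ns_edge R) : center R :=
  fun '(i, j) => h^-1 * (v (i, j) - v (i, j.-1)).

Definition A_x (R : realType) (phi : center R) : ew_edge R :=
  fun '(i, j) => 2^-1 * (phi (i.+1, j) + phi (i, j)).
Definition D_x (R : realType) (h : R) (phi : center R) : ew_edge R :=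
  fun '(i, j) => h^-1 * (phi (i.+1, j) - phi (i, j)).
Definition A_y (R : realType) (phi : center R) : ns_edge R :=
  fun '(i, j) => 2^-1 * (phi (i, j.+1) + phi (i, j)).
Definition D_y (R : realType) (h : R) (phi : center R) : ns_edge R :=
  fun '(i, j) => h^-1 * (phi (i, j.+1) - phi (i, j)).

(* center to vertex *)
Definition cA (R : realType) (phi : center R) : vertex R :=
  fun '(i, j) =>
    4^-1 * (phi (i.+1, j.+1) + phi (i, j.+1) + phi (i.+1, j) + phi (i, j)).

(* edge to vertex, with c for calligraphic *)
Definition cA_x (R : realType) (v : ns_edge R) : vertex R :=
  fun '(i, j) => 2^-1 * (v (i.+1, j) + v (i, j)).
Definition cD_x (R : realType) (h : R) (v : ns_edge R) : vertex R :=
  fun '(i, j) => h^-1 * (v (i.+1, j) - v (i, j)).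
Definition cA_y (R : realType) (u : ew_edge R) : vertex R :=
  fun '(i, j) => 2^-1 * (u (i, j.+1) + u (i, j)).
Definition cD_y (R : realType) (h : R) (u : ew_edge R) : vertex R :=
  fun '(i, j) => h^-1 * (u (i, j.+1) - u (i, j)).

(* vertex to edge, with f for Fraktur *)
Definition fA_x (R : realType) (f : vertex R) : ns_edge R :=
  fun '(i, j) => 2^-1 * (f (i, j) + f (i.-1, j)).
Definition fD_x (R : realType) (h : R) (f : vertex R) : ns_edge R :=
  fun '(i, j) => h^-1 * (f (i, j) - f (i.-1, j)).
Definition fA_y (R : realType) (f : vertex R) : ew_edge R :=
  fun '(i, j) => 2^-1 * (f (i, j) + f (i, j.-1)).
Definition fD_y (R : realType) (h : R) (f : vertex R) : ew_edge R :=
  fun '(i, j) => h^-1 * (f (i, j) - f (i, j.-1)).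

(* a_x (rho_ew D_x c u) and a_y (rho_ns D_y c v): the density factor is taken
   at the center lying across the edge *)
Definition adv_x (R : realType) (h : R) (rho c : center R) (u : ew_edge R)
    : center R :=
  fun '(i, j) => 2^-1 * (rho (i.+1, j) * D_x h c (i, j) * u (i, j)
                         + rho (i.-1, j) * D_x h c (i.-1, j) * u (i.-1, j)).
Definition adv_y (R : realType) (h : R) (rho c : center R) (v : ns_edge R)
    : center R :=
  fun '(i, j) => 2^-1 * (rho (i, j.+1) * D_y h c (i, j) * v (i, j)
                         + rho (i, j.-1) * D_y h c (i, j.-1) * v (i, j.-1)).

(* A_x (rho_ew mu) and A_y (rho_ns mu) *)
Definition st_x (R : realType) (rho mu : center R) : ew_edge R :=
  fun '(i, j) => 2^-1 * (rho (i.+1, j) * mu (i, j) + rho (i, j) * mu (i.+1, j)).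
Definition st_y (R : realType) (rho mu : center R) : ns_edge R :=
  fun '(i, j) => 2^-1 * (rho (i, j.+1) * mu (i, j) + rho (i, j) * mu (i, j.+1)).

(* |nabla_D c|^2 = a_x ((D_x c)^2) + a_y ((D_y c)^2) *)
Definition sqgrad (R : realType) (h : R) (c : center R) : center R :=
  fun x => a_x (D_x h c \* D_x h c) x + a_y (D_y h c \* D_y h c) x.

Definition tavg (R : realType) (f g : center R) : center R :=
  fun x => 2^-1 * (f x + g x).

Definition inner2 (R : realType) (m1 m2 : nat) (phi psi : center R) : R :=
  \sum_(1 <= i < m1.+1) \sum_(1 <= j < m2.+1) phi (i, j) * psi (i, j).

Record params (R : realType) := Params {
  pM : R; pRe : R; pWe : R; pFr : R; pPe : R;
  peta : R; peps : R;
  rho1 : R; rho2 : R; mu1 : R; mu2 : R;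
  dt : R }.

Definition positive_params (R : realType) (P : params R) : Prop :=
  [/\ [/\ 0 < pM P, 0 < pRe P, 0 < pWe P, 0 < pFr P & 0 < pPe P],
      0 < peta P /\ 0 < peps P,
      [/\ 0 < rho1 P, 0 < rho2 P, 0 < mu1 P & 0 < mu2 P]
    & 0 < dt P].

Definition alpha (R : realType) (P : params R) : R :=
  (rho2 P - rho1 P) / (rho1 P * rho2 P).
Definition rho (R : realType) (P : params R) (c : R) : R :=
  rho1 P * rho2 P / ((rho2 P - rho1 P) * c + rho1 P).
Definition visc (R : realType) (P : params R) (c : R) : R :=
  mu1 P * mu2 P / ((mu2 P - mu1 P) * c + mu1 P).
Definition mob (R : realType) (P : params R) (c : R) : R :=
  Num.sqrt (c ^+ 2 * (1 - c) ^+ 2 + peps P).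
Definition Fpot (R : realType) (c : R) : R := c ^+ 2 * (c - 1) ^+ 2 / 4.
Definition gfun (R : realType) (a b : R) : R :=
  4^-1 * (a * (a - 1) + b * (b - 1)) * (a + b - 1).
Definition rfun (R : realType) (P : params R) (a b : R) : R :=
  - alpha P * rho P a * rho P b.

Record level (R : realType) := Level {
  conc : center R;                        (* c *)
  mubar : center R;                       (* \bar\mu_c *)
  pbar : center R;                        (* \bar p *)
  ut : ew_edge R; vt : ns_edge R;         (* \tilde u, \tilde v *)
  uu : ew_edge R; vv : ns_edge R }.       (* u, v *)

Definition chempot (R : realType) (P : params R) (S : level R) : center R :=
  fun x => mubar S x + alpha P * pbar S x.

Definition admissible (R : realType) (P : params R) (m1 m2 : nat) (c : center R)
    : Prop :=
  forall i j, (i <= m1.+1)%N -> (j <= m2.+1)%N ->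
    0 < (rho2 P - rho1 P) * c (i, j) + rho1 P /\
    0 < (mu2 P - mu1 P) * c (i, j) + mu1 P.

(* S holds the data at time level n, S' those at level n + 1. *)

Definition J1 (R : realType) (P : params R) (h : R) (S S' : level R)
    (i j : nat) : Prop :=
  let rn := rho P \o conc S in
  let rn1 := rho P \o conc S' in
  let mun := visc P \o conc S in
  A_x rn (i, j) * ((ut S' (i, j) - uu S (i, j)) / dt P)
  + A_x (rn \* a_x (uu S) \* d_x h (ut S')) (i, j)
  + fA_y (cA rn \* cA_x (vv S) \* cD_y h (ut S')) (i, j)
  + 2^-1 * ut S' (i, j) *
    ((A_x rn1 (i, j) - A_x rn (i, j)) / dt P
     + D_x h (rn \* a_x (uu S)) (i, j)
     + fD_y h (cA rn \* cA_x (vv S)) (i, j))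
  = (pRe P)^-1 *
      (D_x h (mun \* d_x h (ut S')) (i, j)
       + fD_y h (cA mun \* cD_y h (ut S')) (i, j))
    + (3 * pRe P)^-1 *
      D_x h (mun \* (d_x h (ut S') \+ d_y h (vt S'))) (i, j).

Definition J2 (R : realType) (P : params R) (h : R) (S S' : level R)
    (i j : nat) : Prop :=
  let rn := rho P \o conc S in
  let rn1 := rho P \o conc S' in
  let mun := visc P \o conc S in
  A_y rn (i, j) * ((vt S' (i, j) - vv S (i, j)) / dt P)
  + fA_x (cA rn \* cA_y (uu S) \* cD_x h (vt S')) (i, j)
  + A_y (rn \* a_y (vv S) \* d_y h (vt S')) (i, j)
  + 2^-1 * vt S' (i, j) *
    ((A_y rn1 (i, j) - A_y rn (i, j)) / dt P
     + fD_x h (cA rn \* cA_y (uu S)) (i, j)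
     + D_y h (rn \* a_y (vv S)) (i, j))
  = (pRe P)^-1 *
      (fD_x h (cA mun \* cD_x h (vt S')) (i, j)
       + D_y h (mun \* d_y h (vt S')) (i, j))
    + (3 * pRe P)^-1 *
      D_y h (mun \* (d_x h (ut S') \+ d_y h (vt S'))) (i, j).

Definition J3 (R : realType) (P : params R) (h : R) (S' : level R)
    (i j : nat) : Prop :=
  let rn1 := rho P \o conc S' in
  A_x rn1 (i, j) * ((uu S' (i, j) - ut S' (i, j)) / dt P)
  = - ((pM P)^-1 * D_x h (pbar S') (i, j))
    + (pM P)^-1 * (st_x rn1 (mubar S') (i, j) * D_x h (conc S') (i, j)).

Definition J4 (R : realType) (P : params R) (h : R) (S' : level R)
    (i j : nat) : Prop :=
  let rn1 := rho P \o conc S' in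
  A_y rn1 (i, j) * ((vv S' (i, j) - vt S' (i, j)) / dt P)
  = - ((pM P)^-1 * D_y h (pbar S') (i, j))
    + (pM P)^-1 * (st_y rn1 (mubar S') (i, j) * D_y h (conc S') (i, j))
    - (pFr P)^-1 * A_y rn1 (i, j).

Definition Qflux (R : realType) (P : params R) (h : R) (S S' : level R)
    : center R :=
  let mn := mob P \o conc S in
  fun x =>
    (pPe P)^-1 * (d_x h (A_x mn \* D_x h (mubar S')) x
                  + d_y h (A_y mn \* D_y h (mubar S')) x)
    + alpha P / pPe P * (d_x h (A_x mn \* D_x h (pbar S')) x
                         + d_y h (A_y mn \* D_y h (pbar S')) x).

Definition J5 (R : realType) (P : params R) (h : R) (S S' : level R)
    (i j : nat) : Prop :=
  d_x h (uu S') (i, j) + d_y h (vv S') (i, j) = alpha P * Qflux P h S S' (i, j).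

Definition J6 (R : realType) (P : params R) (h : R) (S S' : level R)
    (i j : nat) : Prop :=
  let rn := rho P \o conc S in
  let rn1 := rho P \o conc S' in
  rn (i, j) * ((conc S' (i, j) - conc S (i, j)) / dt P)
  + adv_x h rn1 (conc S') (uu S') (i, j)
  + adv_y h rn1 (conc S') (vv S') (i, j)
  = Qflux P h S S' (i, j).

Definition J7 (R : realType) (P : params R) (h : R) (S S' : level R)
    (i j : nat) : Prop :=
  let rn := rho P \o conc S in
  let rn1 := rho P \o conc S' in
  let rhalf := tavg rn1 rn in
  let chalf := tavg (conc S') (conc S) in
  let Fhalf := tavg (@Fpot R \o conc S') (@Fpot R \o conc S) in
  let Ghalf := tavg (sqgrad h (conc S')) (sqgrad h (conc S)) in
  let gn := gfun (conc S' (i, j)) (conc S (i, j)) in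
  let rr := rfun P (conc S' (i, j)) (conc S (i, j)) in
  rn (i, j) * mubar S' (i, j)
  = pM P * peta P / (peps P * pWe P) * (rhalf (i, j) * gn)
    + pM P * peta P / (peps P * pWe P) * (Fhalf (i, j) * rr)
    + peps P * peta P * pM P / (2 * pWe P) * (Ghalf (i, j) * rr)
    - peps P * peta P * pM P / pWe P *
      (d_x h (A_x rhalf \* D_x h chalf) (i, j)
       + d_y h (A_y rhalf \* D_y h chalf) (i, j)).

Definition projection_step (R : realType) (P : params R) (h : R) (m1 m2 : nat)
    (S S' : level R) : Prop :=
  [/\ forall i j, (1 <= i <= m1.-1)%N -> (1 <= j <= m2)%N ->
        J1 P h S S' i j /\ J3 P h S' i j,
      forall i j, (1 <= i <= m1)%N -> (1 <= j <= m2.-1)%N ->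
        J2 P h S S' i j /\ J4 P h S' i j
    & forall i j, (1 <= i <= m1)%N -> (1 <= j <= m2)%N ->
        [/\ J5 P h S S' i j, J6 P h S S' i j & J7 P h S S' i j]].

Definition neumann (R : realType) (m1 m2 : nat) (phi : center R) : Prop :=
  (forall j, (1 <= j <= m2)%N ->
     phi (0%N, j) = phi (1%N, j) /\ phi (m1.+1, j) = phi (m1, j)) /\
  (forall i, (1 <= i <= m1)%N ->
     phi (i, 0%N) = phi (i, 1%N) /\ phi (i, m2.+1) = phi (i, m2)).

Definition no_slip (R : realType) (m1 m2 : nat) (u : ew_edge R) (v : ns_edge R)
    : Prop :=
  [/\ forall j, (1 <= j <= m2)%N -> u (0%N, j) = 0 /\ u (m1, j) = 0,
      forall i, (i <= m1)%N ->
        2^-1 * (u (i, 0%N) + u (i, 1%N)) = 0 /\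
        2^-1 * (u (i, m2) + u (i, m2.+1)) = 0,
      forall i, (1 <= i <= m1)%N -> v (i, 0%N) = 0 /\ v (i, m2) = 0
    & forall j, (j <= m2)%N ->
        2^-1 * (v (0%N, j) + v (1%N, j)) = 0 /\
        2^-1 * (v (m1, j) + v (m1.+1, j)) = 0].

Definition no_flux (R : realType) (m1 m2 : nat) (u : ew_edge R) (v : ns_edge R)
    : Prop :=
  (forall j, (1 <= j <= m2)%N -> u (0%N, j) = 0 /\ u (m1, j) = 0) /\
  (forall i, (1 <= i <= m1)%N -> v (i, 0%N) = 0 /\ v (i, m2) = 0).

Definition boundary_conditions (R : realType) (P : params R) (m1 m2 : nat)
    (S : level R) : Prop :=
  [/\ neumann m1 m2 (conc S), neumann m1 m2 (chempot P S),
      no_slip m1 m2 (ut S) (vt S) & no_flux m1 m2 (uu S) (vv S)].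

(* Main.v *)
Require Import Defs.
From mathcomp Require Import all_boot all_order all_algebra.
From mathcomp Require Import reals.
From mathcomp Require Import ring.

(** Conservation of mass is a discrete continuity equation summed over the
    cells.  The reciprocal of the density is affine in the concentration with
    slope [alpha], so a difference of densities is exactly
    [- alpha * rho a * rho b] times the difference of concentrations
    ([rho_sub]): the chain rule of the continuous model survives
    discretization without error.

    Multiply the concentration equation [J6] by [alpha] times the new density
    at the cell.  By [rho_sub], the time difference of [conc] becomes minus
    that of the density.  The advection terms take the density from the cell
    across the edge, so the factor at the cell itself completes the product of
    two densities that turns the difference of [conc] into one of the density.
    The right-hand side [alpha * rho * Qflux] is the density times the discrete
    divergence of the velocity, by [J5].  The discrete product rule
    ([d_x_mass_flux], [d_y_mass_flux]) merges the advection and divergence terms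
    into the divergence of the mass flux, and this yields the conservative
    equation [mass_balance].  Summed over the grid, its divergence telescopes to
    the normal fluxes through the boundary, and these vanish because the normal
    velocity does. *)

Set Implicit Arguments.
Unset Strict Implicit.
Unset Printing Implicit Defensive.

Import GRing.Theory Num.Theory.
Local Open Scope ring_scope.

(** [rho P] is the reciprocal of the affine function
    [alpha P * c + (rho2 P)^-1]; the identity is
    [1 / x - 1 / y = - (x - y) / (x * y)]. *)
Lemma rho_sub (R : realType) (P : params R) (a b : R) :
  positive_params P ->
  0 < (rho2 P - rho1 P) * a + rho1 P -> 0 < (rho2 P - rho1 P) * b + rho1 P ->
  rho P a - rho P b = - (alpha P * rho P a * rho P b * (a - b)).
Proof.
case=> _ _ [r1_gt0 r2_gt0 _ _] _ a_gt0 b_gt0.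
rewrite /rho /alpha; field.
by rewrite !lt0r_neq0.
Qed.

(** The product rule [d (A r * u) = r * d u + a (D r * u)] on three consecutive
    cells W, C, E and the two edges between them.  Each one-sided difference of
    [r] is rewritten through that of [c]; the factor [rC] is common to both, and
    what remains are the densities [rE] and [rW] across the edges. *)
Lemma edge_product_rule (R : realType) (h al rW rC rE cW cC cE uW uE : R) :
  rC - rW = - (al * rC * rW * (cC - cW)) ->
  rE - rC = - (al * rE * rC * (cE - cC)) ->
  h^-1 * (2^-1 * (rE + rC) * uE - 2^-1 * (rC + rW) * uW)
  = rC * (h^-1 * (uE - uW))
    - al * rC * (2^-1 * (rE * (h^-1 * (cE - cC)) * uE
                         + rW * (h^-1 * (cC - cW)) * uW)).
Proof.
move=> subCW subEC.
transitivity (rC * (h^-1 * (uE - uW))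
              + 2^-1 * h^-1 * ((rE - rC) * uE + (rC - rW) * uW)).
  rewrite [in LHS](_ : rE + rC = 2 * rC + (rE - rC)); last by ring.
  rewrite [in LHS](_ : rC + rW = 2 * rC - (rC - rW)); last by ring.
  rewrite !mulrDr mulKf ?pnatr_eq0 // mulrN; ring.
rewrite subCW subEC; ring.
Qed.

Lemma d_x_mass_flux (R : realType) (P : params R) (h : R) (m1 m2 i j : nat)
    (c : center R) (u : ew_edge R) :
  positive_params P -> admissible P m1 m2 c ->
  (1 <= i <= m1)%N -> (1 <= j <= m2)%N ->
  d_x h (A_x (rho P \o c) \* u) (i, j)
  = rho P (c (i, j)) * d_x h u (i, j)
    - alpha P * rho P (c (i, j)) * adv_x h (rho P \o c) c u (i, j).
Proof.
case: i => // i hP hc /= lt_i_m1 /andP[_ /leqW le_j].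
have [cW _] := hc i j (leqW (ltnW lt_i_m1)) le_j.
have [cC _] := hc i.+1 j (leqW lt_i_m1) le_j.
have [cE _] := hc i.+2 j lt_i_m1 le_j.
exact: edge_product_rule (rho_sub hP cC cW) (rho_sub hP cE cC).
Qed.

Lemma d_y_mass_flux (R : realType) (P : params R) (h : R) (m1 m2 i j : nat)
    (c : center R) (v : ns_edge R) :
  positive_params P -> admissible P m1 m2 c ->
  (1 <= i <= m1)%N -> (1 <= j <= m2)%N ->
  d_y h (A_y (rho P \o c) \* v) (i, j)
  = rho P (c (i, j)) * d_y h v (i, j)
    - alpha P * rho P (c (i, j)) * adv_y h (rho P \o c) c v (i, j).
Proof.
case: j => // j hP hc /andP[_ /leqW le_i] /= lt_j_m2.
have [cS _] := hc i j le_i (leqW (ltnW lt_j_m2)).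
have [cC _] := hc i j.+1 le_i (leqW lt_j_m2).
have [cN _] := hc i j.+2 le_i lt_j_m2.
exact: edge_product_rule (rho_sub hP cC cS) (rho_sub hP cN cC).
Qed.

(** The continuity equation hidden in the scheme: [J6] multiplied by [alpha]
    and the new density, with [J5] inserted on the right.  No division by
    [alpha] takes place, so equal densities [rho1 P = rho2 P] are covered. *)
Lemma mass_balance (R : realType) (P : params R) (h : R) (m1 m2 i j : nat)
    (S S' : level R) :
  positive_params P ->
  admissible P m1 m2 (conc S) -> admissible P m1 m2 (conc S') ->
  (1 <= i <= m1)%N -> (1 <= j <= m2)%N ->
  J5 P h S S' i j -> J6 P h S S' i j ->
  rho P (conc S' (i, j)) - rho P (conc S (i, j))
  = - dt P * (d_x h (A_x (rho P \o conc S') \* uu S') (i, j)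
              + d_y h (A_y (rho P \o conc S') \* vv S') (i, j)).
Proof.
move=> hP hc hc' hi hj div_uv adv_c.
have dt_neq0 : dt P != 0 by case: hP => _ _ _ /lt0r_neq0.
have [/andP[_ /leqW le_i] /andP[_ /leqW le_j]] := (hi, hj).
have [[c_gt0 _] [c'_gt0 _]] := (hc i j le_i le_j, hc' i j le_i le_j).
rewrite (d_x_mass_flux _ _ hP hc' hi hj) (d_y_mass_flux _ _ hP hc' hi hj).
rewrite (rho_sub hP c'_gt0 c_gt0).
move: div_uv; rewrite /J5 -adv_c /comp => /(canRL (addrK _)) ->.
by field.
Qed.

Lemma sum_d_x (R : realType) (h : R) (m j : nat) (u : ew_edge R) :
  \sum_(1 <= i < m.+1) d_x h u (i, j) = h^-1 * (u (m, j) - u (0%N, j)).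
Proof.
by rewrite big_add1 -mulr_sumr (telescope_sumr (fun i => u (i, j))).
Qed.

Lemma sum_d_y (R : realType) (h : R) (m i : nat) (v : ns_edge R) :
  \sum_(1 <= j < m.+1) d_y h v (i, j) = h^-1 * (v (i, m) - v (i, 0%N)).
Proof.
by rewrite big_add1 -mulr_sumr (telescope_sumr (fun j => v (i, j))).
Qed.

(** The discrete divergence theorem for a flux whose normal component vanishes
    on the boundary. *)
Lemma sum_div_no_flux (R : realType) (h : R) (m1 m2 : nat)
    (u : ew_edge R) (v : ns_edge R) :
  no_flux m1 m2 u v ->
  \sum_(1 <= i < m1.+1) \sum_(1 <= j < m2.+1)
    (d_x h u (i, j) + d_y h v (i, j)) = 0.
Proof.
case=> u0 v0.
under eq_bigr do rewrite big_split.
rewrite big_split exchange_big /= !big_nat big1 ?add0r => [|j /u0[u0j umj]].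
  by rewrite big1 // => i /v0[vi0 vim]; rewrite sum_d_y vi0 vim subrr mulr0.
by rewrite sum_d_x u0j umj subrr mulr0.
Qed.

Theorem theorem6p3 (R : realType) (P : params R) (h Lx Ly : R) (m1 m2 : nat)
    (S : nat -> level R)
    (hP : positive_params P) (hh : 0 < h)
    (hm1 : (0 < m1)%N) (hm2 : (0 < m2)%N)
    (hLx : Lx = m1%:R * h) (hLy : Ly = m2%:R * h) (hL : Lx = Ly)
    (hadm : forall n, admissible P m1 m2 (conc (S n)))
    (hscheme : forall n, projection_step P h m1 m2 (S n) (S n.+1))
    (hbc : forall n, boundary_conditions P m1 m2 (S n)) :
  forall n, inner2 m1 m2 (rho P \o conc (S n.+1)) (fun=> 1)
          = inner2 m1 m2 (rho P \o conc (S n)) (fun=> 1).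
Proof.
move=> n; have [_ _ step] := hscheme n; have [_ _ _ [u0 v0]] := hbc n.+1.
set flux_u := A_x (rho P \o conc (S n.+1)) \* uu (S n.+1).
set flux_v := A_y (rho P \o conc (S n.+1)) \* vv (S n.+1).
have flux0 : no_flux m1 m2 flux_u flux_v.
  split=> [j /u0[u0j umj]|i /v0[vi0 vim]].
    by rewrite /flux_u /= u0j umj !mulr0.
  by rewrite /flux_v /= vi0 vim !mulr0.
apply/eqP; rewrite -subr_eq0 -sumrB; apply/eqP.
transitivity (- dt P * \sum_(1 <= i < m1.+1) \sum_(1 <= j < m2.+1)
                (d_x h flux_u (i, j) + d_y h flux_v (i, j))); last first.
  by rewrite (sum_div_no_flux _ flux0) mulr0.
rewrite mulr_sumr; apply: eq_big_nat => i hi.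
rewrite -sumrB mulr_sumr; apply: eq_big_nat => j hj.
have [div_uv adv_c _] := step i j hi hj.
rewrite !mulr1.
exact: mass_balance (hadm n) (hadm n.+1) hi hj div_uv adv_c.
Qed.
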